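(* Every purely inseparable extension $K/k$ of unbounded exponent which is modular and $w_0$-generated is $q$-finite.
   Context: All fields have characteristic $p>0$ and all extensions are purely inseparable subextensions of a fixed algebraic closure $\Omega$ of $k$. $K/k$ is of finite (bounded) exponent if $K^{p^e}\subseteq k$ for some $e\in\mathbf N$; otherwise it is of unbounded exponent. An $r$-basis of $K/k$ is a subset $B\subseteq K$ with $K=k(K^p)(B)$ and $x\notin k(K^p)(B\setminus\{x\})$ for all $x\in B$; all $r$-bases have the same cardinality. If $K/k$ has finite exponent, $di(K/k)$ denotes the cardinality of an $r$-basis (equivalently of a minimal generating set). In general $di(K/k)=\sup_{n\ge 1} di\big((k^{p^{-n}}\cap K)/k\big)$, where $k^{p^{-n}}=\{a\in\Omega : a^{p^n}\in k\}$. $K/k$ is $q$-finite if $di(K/k)$ is finite. $K/k$ is modular if for every $n\in\mathbf N$, $K^{p^n}$ and $k$ are linearly disjoint over $K^{p^n}\cap k$. $K/k$ is $w_0$-generated if it has no proper subextension $L/k$ ($k\subseteq L\subsetneq K$) of unbounded exponent. *)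

(* Defs.v *)
From HB Require Import structures.
From mathcomp Require Import all_boot all_order all_algebra.
From mathcomp Require Import boolp classical_sets functions cardinality.

Set Implicit Arguments.
Unset Strict Implicit.
Unset Printing Implicit Defensive.

Import GRing.Theory.
Local Open Scope classical_set_scope.
Local Open Scope card_scope.
Local Open Scope ring_scope.

(* Every field involved is a subfield of one fixed field [Omega], given as a
   set; [k] and [K] stand for the bottom and the top of an extension.         *)

Definition is_subfield (Omega : fieldType) (F : set Omega) : Prop :=
  GRing.divring_closed (mem F).

Definition subextension (Omega : fieldType) (k L K : set Omega) : Prop :=
  [/\ is_subfield L, k `<=` L & L `<=` K].

(* F(S) *)
Definition adjoin (Omega : fieldType) (F S : set Omega) : set Omega :=
  smallest (@is_subfield Omega) (F `|` S).

(* F^{p^n} and F^{p^{-n}} *)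
Definition frob_image (Omega : fieldType) (p n : nat) (F : set Omega) :
    set Omega :=
  [set x ^+ (p ^ n)%N | x in F].

Definition frob_preimage (Omega : fieldType) (p n : nat) (F : set Omega) :
    set Omega :=
  [set x | F (x ^+ (p ^ n)%N)].

Definition purely_inseparable (Omega : fieldType) (p : nat)
    (k K : set Omega) : Prop :=
  forall x, K x -> exists n : nat, k (x ^+ (p ^ n)%N).

Definition finite_exponent (Omega : fieldType) (p : nat)
    (k K : set Omega) : Prop :=
  exists e : nat, frob_image p e K `<=` k.

Definition unbounded_exponent (Omega : fieldType) (p : nat)
    (k K : set Omega) : Prop :=
  ~ finite_exponent p k K.

Definition r_basis (Omega : fieldType) (p : nat) (k K B : set Omega) : Prop :=
  let kKp := adjoin k (frob_image p 1 K) in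
  [/\ B `<=` K,
      K = adjoin kKp B &
      forall x, B x -> ~ adjoin kKp (B `\ x) x].

(* The cardinal |D| bounds di((k^{p^{-n}} ∩ K)/k) for all n >= 1.  Each of these
   extensions has finite exponent, so its di is the cardinality of any of its
   r-bases. *)
Definition di_upper_bound (Omega : fieldType) (p : nat) (k K : set Omega)
    (T : Type) (D : set T) : Prop :=
  forall n : nat, (1 <= n)%N ->
    exists2 B : set Omega,
      r_basis p k (frob_preimage p n k `&` K) B & B #<= D.

(* di(K/k) = |D|, as a least upper bound of cardinals.  Subsets of [Omega] are
   enough for the comparison: being a supremum of cardinalities of subsets of
   [Omega], di(K/k) is itself such a cardinality. *)
Definition is_di (Omega : fieldType) (p : nat) (k K : set Omega)
    (T : Type) (D : set T) : Prop :=
  di_upper_bound p k K D /\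
  forall E : set Omega, di_upper_bound p k K E -> D #<= E.

Definition q_finite (Omega : fieldType) (p : nat) (k K : set Omega) : Prop :=
  exists d : nat, is_di p k K `I_d.

Definition lin_indep (Omega : fieldType) (F : set Omega) (m : nat)
    (x : 'I_m -> Omega) : Prop :=
  forall c : 'I_m -> Omega, (forall i, F (c i)) ->
    \sum_(i < m) c i * x i = 0 -> forall i, c i = 0.

(* A and B are linearly disjoint over C, for C contained in A and in B.  The
   condition is symmetric in A and B. *)
Definition linearly_disjoint (Omega : fieldType) (A B C : set Omega) : Prop :=
  forall (m : nat) (x : 'I_m -> Omega),
    (forall i, A (x i)) -> lin_indep C x -> lin_indep B x.

Definition modular (Omega : fieldType) (p : nat) (k K : set Omega) : Prop :=
  forall n : nat,
    linearly_disjoint (frob_image p n K) k (frob_image p n K `&` k).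

Definition w0_generated (Omega : fieldType) (p : nat)
    (k K : set Omega) : Prop :=
  ~ exists L : set Omega,
      [/\ subextension k L K, L <> K & unbounded_exponent p k L].

(* Main.v *)
Require Import Defs.
From HB Require Import structures.
From mathcomp Require Import all_boot all_order all_algebra.
From mathcomp Require Import boolp classical_sets functions cardinality.

Set Implicit Arguments.
Unset Strict Implicit.
Unset Printing Implicit Defensive.

Import GRing.Theory.
Local Open Scope classical_set_scope.
Local Open Scope ring_scope.

(* Write K_n for the elements x of K with x^(p^n) in k.  Since k(K^(p^m)) again
   has unbounded exponent, K = k(K^(p^m)) for every m, and modularity then gives
   K_1 = k(K_n^(p^(n-1))) for every n.

   Suppose K_1 is infinite over k and fix a in K_1 outside k.  For F finite over
   k with a outside F, some b in K_n has b^(p^(n-1)) outside the finite extension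
   F(a); then b has degree p^n over both F and F(a), so a is not in F(b).
   Iterating over n gives an extension of unbounded exponent that avoids a.

   So K_1 is finite over k, and has a k-basis of elements z_i^(p^(n-1)) with z_i
   in K_n.  By modularity the coordinates of x^(p^j), for x in K_(j+1), are
   p^j-th powers of elements of K_j; by induction on j, K_n = k(z_1, .., z_r), and
   r is bounded by [K_1 : k]. *)

(** * Subfields of [Omega] given as sets *)

Record subfield (Omega : fieldType) :=
  Subfield { carrier : set Omega; carrierP : is_subfield carrier }.

Definition subfield_pred (Omega : fieldType) (F : subfield Omega) :
  {pred Omega} := mem (carrier F).

HB.instance Definition _ (Omega : fieldType) (F : subfield Omega) :=
  GRing.isDivringClosed.Build Omega (subfield_pred F) (carrierP F).

Definition subfield_type (Omega : fieldType) (F : subfield Omega) :=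
  {x : Omega | x \in subfield_pred F}.

HB.instance Definition _ (Omega : fieldType) (F : subfield Omega) :=
  SubChoice.on (subfield_type F).
HB.instance Definition _ (Omega : fieldType) (F : subfield Omega) :=
  [SubChoice_isSubComUnitRing of subfield_type F by <:].
HB.instance Definition _ (Omega : fieldType) (F : subfield Omega) :=
  [SubComUnitRing_isSubIntegralDomain of subfield_type F by <:].
HB.instance Definition _ (Omega : fieldType) (F : subfield Omega) :=
  [SubIntegralDomain_isSubField of subfield_type F by <:].

(** This makes matrix rank and polynomial gcd, which need a [fieldType] of coefficients, available
    over a subfield that is only a set. *)
Lemma subfield_range (Omega : fieldType) (F : set Omega) : is_subfield F ->
  exists (k : fieldType) (j : {rmorphism k -> Omega}), F = range j.
Proof.
move=> hF; exists (subfield_type (Subfield hF)).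
exists (val : {rmorphism subfield_type (Subfield hF) -> Omega}).
apply/seteqP; split=> [x Fx|_ [x _ <-]].
  have hx : x \in subfield_pred (Subfield hF) by apply/mem_set.
  by exists (Sub x hx : subfield_type (Subfield hF)).
by have := valP x => /set_mem.
Qed.

Lemma is_subfieldP (Omega : fieldType) (F : set Omega) : is_subfield F <->
  [/\ F 1, (forall x y, F x -> F y -> F (x - y)) &
      forall x y, F x -> F y -> F (x / y)].
Proof.
split=> [[/set_mem F1 FB FV]|[F1 FB FV]]; split=> //.
- by move=> x y Fx Fy; apply/set_mem/FB; apply/mem_set.
- by move=> x y Fx Fy; apply/set_mem/FV; apply/mem_set.
- exact/mem_set.
- by move=> x y /set_mem Fx /set_mem Fy; apply/mem_set/FB.
- by move=> x y /set_mem Fx /set_mem Fy; apply/mem_set/FV.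
Qed.

Section SubfieldTheory.
Variables (Omega : fieldType) (F : set Omega) (hF : is_subfield F).

Lemma subfield1 : F 1. Proof. by case/is_subfieldP: hF. Qed.

Lemma subfieldB x y : F x -> F y -> F (x - y).
Proof. by case/is_subfieldP: hF => _ + _; apply. Qed.

Lemma subfield_div x y : F x -> F y -> F (x / y).
Proof. by case/is_subfieldP: hF => _ _; apply. Qed.

Lemma subfield0 : F 0.
Proof. by rewrite -(subrr 1); apply: subfieldB; apply: subfield1. Qed.

Lemma subfieldN x : F x -> F (- x).
Proof.
by move=> Fx; rewrite -sub0r; apply: subfieldB => //; apply: subfield0.
Qed.

Lemma subfieldD x y : F x -> F y -> F (x + y).
Proof.
by move=> Fx Fy; rewrite -[y]opprK; apply: subfieldB => //; apply: subfieldN.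
Qed.

Lemma subfieldV x : F x -> F x^-1.
Proof.
by move=> Fx; rewrite -div1r; apply: subfield_div => //; apply: subfield1.
Qed.

Lemma subfieldM x y : F x -> F y -> F (x * y).
Proof.
by move=> Fx Fy; rewrite -[y]invrK; apply: subfield_div => //; apply: subfieldV.
Qed.

Lemma subfieldX n x : F x -> F (x ^+ n).
Proof.
move=> Fx; elim: n => [|n IH]; first by rewrite expr0; apply: subfield1.
by rewrite exprS; apply: subfieldM.
Qed.

End SubfieldTheory.

(** * Adjunction and linear spans *)

Section Adjoin.
Variable Omega : fieldType.
Implicit Types F S L E : set Omega.

Lemma adjoin_subfield F S : is_subfield (adjoin F S).
Proof.
apply/is_subfieldP; split=> [|x y Fx Fy|x y Fx Fy] L [hL FS].
- exact: subfield1.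
- by apply: (subfieldB hL); [apply: Fx|apply: Fy].
- by apply: (subfield_div hL); [apply: Fx|apply: Fy].
Qed.

Lemma sub_adjoin F S : F `|` S `<=` adjoin F S.
Proof. exact: sub_gen_smallest. Qed.

Lemma adjoin_base F S : F `<=` adjoin F S.
Proof. by move=> x Fx; apply: sub_adjoin; left. Qed.

Lemma adjoin_gen F S : S `<=` adjoin F S.
Proof. by move=> x Sx; apply: sub_adjoin; right. Qed.

Lemma adjoin_min F S L :
  is_subfield L -> F `<=` L -> S `<=` L -> adjoin F S `<=` L.
Proof. by move=> hL FL SL; apply: smallest_sub => // x [/FL|/SL]. Qed.

(** Combinations are built one term at a time, so that closure properties follow by induction
    without indexing a finite family. *)
Inductive lspan F E : Omega -> Prop :=
| lspan0 : lspan F E 0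
| lspanMD c y x : F c -> E y -> lspan F E x -> lspan F E (c * y + x).

Lemma lspanD F E x y : lspan F E x -> lspan F E y -> lspan F E (x + y).
Proof.
move=> + Fy; elim=> [|c z {}x Fc Ez _ IH]; first by rewrite add0r.
by rewrite -addrA; apply: lspanMD.
Qed.

Lemma lspanMl F E a x :
  is_subfield F -> F a -> lspan F E x -> lspan F E (a * x).
Proof.
move=> hF Fa; elim=> [|c z {}x Fc Ez _ IH]; first by rewrite mulr0; left.
by rewrite mulrDr mulrA; apply: lspanMD => //; apply: subfieldM.
Qed.

Lemma lspan_gen F E x : is_subfield F -> E x -> lspan F E x.
Proof.
move=> hF Ex; rewrite -[x]mul1r -[_ * _]addr0; apply: lspanMD => //.
  exact: subfield1.
by left.
Qed.

Lemma lspan_trans F E E' : is_subfield F ->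
  E `<=` lspan F E' -> lspan F E `<=` lspan F E'.
Proof.
move=> hF EE' x; elim=> [|c z {}x Fc Ez _ IH]; first by left.
by apply: lspanD => //; apply: lspanMl => //; apply: EE'.
Qed.

Lemma lspan_min F E L :
  is_subfield L -> F `<=` L -> E `<=` L -> lspan F E `<=` L.
Proof.
move=> hL FL EL x; elim=> [|c z {}x Fc Ez _ IH]; first exact: subfield0.
by apply: subfieldD => //; apply: subfieldM => //; [apply: FL|apply: EL].
Qed.

Lemma lspanM F E x y : is_subfield F -> (forall a b, E a -> E b -> E (a * b)) ->
  lspan F E x -> lspan F E y -> lspan F E (x * y).
Proof.
move=> hF EM + Fy; elim=> [|c z {}x Fc Ez _ IH]; first by rewrite mul0r; left.
rewrite mulrDl; apply: lspanD => //; rewrite -mulrA; apply: lspanMl => //.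
elim: Fy {IH} => [|d w {}y Fd Ew _ IH]; first by rewrite mulr0; left.
by rewrite mulrDr mulrCA; apply: lspanMD => //; apply: EM.
Qed.

Lemma lspan_sum (T : finType) F (y : T -> Omega) x : is_subfield F ->
  lspan F (range y) x <->
  exists2 c : T -> Omega, (forall t, F (c t)) & x = \sum_t c t * y t.
Proof.
move=> hF; split=> [|[c Fc ->]].
  elim=> [|a _ {}x Fa [t _ <-] _ [c Fc ->]].
    exists (fun=> 0); first by move=> _; apply: subfield0.
    by rewrite big1 // => t _; rewrite mul0r.
  (* The index [t] may already carry a coefficient, so [a] is added to it. *)
  exists (fun u => c u + (u == t)%:R * a).
    move=> u; apply: subfieldD => //; case: eqP => _; rewrite ?mul1r ?mul0r //.
    exact: subfield0.
  under [RHS]eq_bigr do rewrite /= mulrDl.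
  rewrite big_split /= addrC; congr (_ + _).
  rewrite (bigD1 t) //= eqxx mul1r big1 ?addr0 // => u /negPf ->.
  by rewrite !mul0r.
apply: big_ind => [|u v|t _]; first by left.
- exact: lspanD.
- by apply: lspanMl => //; apply: lspan_gen => //; exists t.
Qed.

End Adjoin.

(** * Linear independence over a subfield *)

Section LinearIndependence.
Variable Omega : fieldType.
Implicit Types F S L E : set Omega.

(** The new vector gets index [ord0], so that [big_ord_recl] splits it off a sum. *)
Definition extend m (x : 'I_m -> Omega) (e : Omega) (i : 'I_m.+1) : Omega :=
  if unlift ord0 i is Some j then x j else e.

Lemma extend0 m (x : 'I_m -> Omega) e : extend x e ord0 = e.
Proof. by rewrite /extend unlift_none. Qed.

Lemma extend_lift m (x : 'I_m -> Omega) e j : extend x e (lift ord0 j) = x j.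
Proof. by rewrite /extend liftK. Qed.

Lemma extend_all m (x : 'I_m -> Omega) e F :
  F e -> (forall i, F (x i)) -> forall i, F (extend x e i).
Proof. by move=> Fe Fx i; rewrite /extend; case: unlift. Qed.

Lemma lin_indepS F L m (x : 'I_m -> Omega) :
  F `<=` L -> lin_indep L x -> lin_indep F x.
Proof. by move=> FL ix c Fc; apply: ix => i; apply: FL. Qed.

Lemma not_lin_indepP F m (x : 'I_m -> Omega) : ~ lin_indep F x ->
  exists c : 'I_m -> Omega,
    [/\ forall i, F (c i), \sum_(i < m) c i * x i = 0 & exists i, c i != 0].
Proof.
apply: contra_notP => nc c Fc sc i; apply/eqP/negP => /negP ci0.
by apply: nc; exists c; split=> //; exists i.
Qed.

(** Since [x] is independent, [e] has a nonzero coefficient in any nontrivial relation; dividing by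
    it solves for [e]. *)
Lemma extend_dep_lspan F m (x : 'I_m -> Omega) e : is_subfield F ->
  lin_indep F x -> ~ lin_indep F (extend x e) -> lspan F (range x) e.
Proof.
move=> hF ix /not_lin_indepP [c [Fc sc [i ci0]]].
move: sc; rewrite big_ord_recl extend0.
under eq_bigr do rewrite extend_lift.
move=> sc.
have c00 : c ord0 != 0.
  apply: contraNN ci0 => /eqP c0; move: sc; rewrite c0 mul0r add0r => sc.
  case: (unliftP ord0 i) => [j ->|-> //]; last exact/eqP.
  by apply/eqP; apply: (ix (fun j => c (lift ord0 j))).
apply/lspan_sum => //; exists (fun j => - (c (lift ord0 j) / c ord0)).
  by move=> j; apply: subfieldN => //; apply: subfield_div.
apply: (mulfI c00); move/eqP: sc; rewrite addr_eq0 => /eqP ->.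
rewrite mulr_sumr -sumrN; apply: eq_bigr => j _.
by rewrite mulrA mulrN mulrCA divff // mulr1 mulNr.
Qed.

Lemma lspan_extend_dep F m (x : 'I_m -> Omega) e : is_subfield F ->
  lspan F (range x) e -> ~ lin_indep F (extend x e).
Proof.
move=> hF /(lspan_sum _ _ hF) [c Fc ec] ix.
have := ix (extend (fun j => - c j) 1); rewrite big_ord_recl !extend0.
under eq_bigr => j _ do rewrite !extend_lift.
move=> /(_ _ _ ord0); rewrite extend0 => h; move/eqP: (oner_neq0 Omega); apply.
apply: h.
  apply: extend_all; first exact: subfield1.
  by move=> j; apply: subfieldN.
by rewrite mul1r ec -big_split big1 //= => i _; rewrite mulNr subrr.
Qed.

(** If [m > #|T|], the [m] by [#|T|] matrix of coordinates has a nonzero left kernel, and a row of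
    it is a relation among the [x i]. *)
Lemma lin_indep_card F m (x : 'I_m -> Omega) (T : finType) (y : T -> Omega) :
  is_subfield F -> lin_indep F x -> (forall i, lspan F (range y) (x i)) ->
  (m <= #|T|)%N.
Proof.
move=> hF ix xy; have [k [j eF]] := subfield_range hF.
have /choice [c hc] i : exists c : T -> k, x i = \sum_t j (c t) * y t.
  have /(lspan_sum _ _ hF) [c Fc ->] := xy i.
  move: Fc; rewrite eF => Fc.
  have /choice [d hd] t : exists d : k, c t = j d.
    by have [d _ <-] := Fc t; exists d.
  by exists d; apply: eq_bigr => t _; rewrite hd.
rewrite leqNgt; apply/negP => lt_Tm.
pose M := \matrix_(i < m, t < #|T|) c i (enum_val t).
have : kermx M != 0.
  rewrite kermx_eq0 /row_free; apply: contraTneq lt_Tm => rM.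
  by rewrite -leqNgt -rM rank_leq_col.
move/rowV0Pn => [u /sub_kermxP uM u0].
have /rV0Pn [i ui] := u0.
have : forall i, j (u 0 i) = 0.
  apply: ix => [i'|]; first by rewrite eF; exists (u 0 i').
  under eq_bigr => i' _ do rewrite hc mulr_sumr.
  rewrite exchange_big big1 //= => t _.
  under eq_bigr => i' _ do rewrite mulrA -rmorphM.
  rewrite -mulr_suml -rmorph_sum /=.
  suff -> : \sum_i' u 0 i' * c i' t = 0 by rewrite rmorph0 mul0r.
  have := congr1 (fun A : 'rV[k]_#|T| => A 0 (enum_rank t)) uM.
  rewrite !mxE => uMt; rewrite -[RHS]uMt; apply: eq_bigr => i' _.
  by rewrite mxE enum_rankK.
by move=> /(_ i) /eqP; rewrite fmorph_eq0 (negPf ui).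
Qed.

End LinearIndependence.

(** * Frobenius powers and purely inseparable extensions *)

Section Frobenius.
Variables (Omega : fieldType) (p : nat) (hp : p \in [pchar Omega]).
Implicit Types F S L E G : set Omega.

Let p_pr : prime p := pcharf_prime hp.

Lemma frobD n (x y : Omega) :
  (x + y) ^+ (p ^ n) = x ^+ (p ^ n) + y ^+ (p ^ n).
Proof. by apply: exprDn_pchar; rewrite pnatX pnatE ?hp. Qed.

Lemma frobN n (x : Omega) : (- x) ^+ (p ^ n) = - x ^+ (p ^ n).
Proof.
apply/eqP; rewrite -addr_eq0 -frobD addNr.
by rewrite expr0n expn_eq0 -leqn0 leqNgt prime_gt0.
Qed.

Lemma frobB n (x y : Omega) :
  (x - y) ^+ (p ^ n) = x ^+ (p ^ n) - y ^+ (p ^ n).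
Proof. by rewrite frobD frobN. Qed.

Lemma frob0 n : (0 : Omega) ^+ (p ^ n) = 0.
Proof. by rewrite expr0n expn_eq0 -leqn0 leqNgt prime_gt0. Qed.

Lemma frob_inj n : injective (fun x : Omega => x ^+ (p ^ n)).
Proof.
move=> x y /= /eqP; rewrite -subr_eq0 -frobB expf_eq0 subr_eq0 => /andP[_].
by move/eqP.
Qed.

Lemma frob_sum n (I : Type) (r : seq I) (P : pred I) (E : I -> Omega) :
  (\sum_(i <- r | P i) E i) ^+ (p ^ n) = \sum_(i <- r | P i) E i ^+ (p ^ n).
Proof. by apply: (big_morph (fun x => x ^+ (p ^ n)) (frobD n) (frob0 n)). Qed.

Lemma frob_image_subfield n F : is_subfield F -> is_subfield (frob_image p n F).
Proof.
move=> hF; apply/is_subfieldP; split.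
- by exists 1; [exact: subfield1|rewrite expr1n].
- move=> _ _ [x Fx <-] [y Fy <-]; exists (x - y); first exact: subfieldB.
  by rewrite frobB.
- move=> _ _ [x Fx <-] [y Fy <-]; exists (x / y); first exact: subfield_div.
  by rewrite expr_div_n.
Qed.

Lemma frob_preimage_subfield n F :
  is_subfield F -> is_subfield (frob_preimage p n F).
Proof.
move=> hF; apply/is_subfieldP; split=> [|x y Fx Fy|x y Fx Fy].
- by rewrite /frob_preimage /= expr1n; apply: subfield1.
- by rewrite /frob_preimage /= frobB; apply: subfieldB.
- by rewrite /frob_preimage /= expr_div_n; apply: subfield_div.
Qed.

Lemma setI_subfield F G :
  is_subfield F -> is_subfield G -> is_subfield (F `&` G).
Proof.
move=> hF hG; apply/is_subfieldP.
split=> [|x y [Fx Gx] [Fy Gy]|x y [Fx Gx] [Fy Gy]].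
- by split; apply: subfield1.
- by split; apply: subfieldB.
- by split; apply: subfield_div.
Qed.

Lemma frob_preimageS F m n : is_subfield F -> (m <= n)%N ->
  frob_preimage p m F `<=` frob_preimage p n F.
Proof.
move=> hF le_mn x; rewrite /frob_preimage /= -(subnKC le_mn) expnD exprM => Fx.
exact: subfieldX.
Qed.

(** The larger of two exponents serves both elements, and Frobenius respects differences and
    quotients. *)
Lemma pinsep_closure_subfield F : is_subfield F ->
  is_subfield [set x | exists n, F (x ^+ (p ^ n))].
Proof.
move=> hF.
have common x y :
    (exists n, F (x ^+ (p ^ n))) -> (exists n, F (y ^+ (p ^ n))) ->
    exists n, F (x ^+ (p ^ n)) /\ F (y ^+ (p ^ n)).
  move=> [m Fx] [n Fy]; exists (maxn m n).
  by split; [apply: (frob_preimageS hF (leq_maxl m n))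
            |apply: (frob_preimageS hF (leq_maxr m n))].
apply/is_subfieldP; split=> [|x y Fx Fy|x y Fx Fy].
- by exists 0; rewrite expr1n; apply: subfield1.
- have [n [Fxn Fyn]] := common _ _ Fx Fy.
  by exists n; rewrite frobB; apply: subfieldB.
- have [n [Fxn Fyn]] := common _ _ Fx Fy.
  by exists n; rewrite expr_div_n; apply: subfield_div.
Qed.

(* A ring between [F] and a purely inseparable extension is a field: if [x ^ q]
   lies in [F], then [x^-1 = x ^ (q - 1) * (x ^ q)^-1]. *)
Lemma adjoin_lspan F E : is_subfield F -> purely_inseparable p F E ->
  E 1 -> (forall a b, E a -> E b -> E (a * b)) -> adjoin F E `<=` lspan F E.
Proof.
move=> hF piE E1 EM.
have S1 : lspan F E 1 by apply: lspan_gen.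
have SF : F `<=` lspan F E.
  by move=> x Fx; rewrite -[x]mulr1; apply: lspanMl.
have SX n x : lspan F E x -> lspan F E (x ^+ n).
  move=> Sx; elim: n => [|n IH]; first by rewrite expr0.
  by rewrite exprS; apply: lspanM.
apply: adjoin_min => //; last by move=> x Ex; apply: lspan_gen.
apply/is_subfieldP; split=> // x y Sx Sy.
  rewrite -[- y]mulN1r; apply: lspanD => //; apply: lspanMl => //.
  by apply: subfieldN => //; apply: subfield1.
apply: lspanM => //; have [->|y0] := eqVneq y 0; first by rewrite invr0; left.
(* The elements with some power [p ^ n] in [F] form a field containing [F] and [E], hence the whole
   span. *)
have [n Fyn] : exists n, F (y ^+ (p ^ n)).
  apply: (lspan_min (pinsep_closure_subfield hF) _ piE Sy) => z Fz.
  by exists 0%N.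
have q0 : (0 < p ^ n)%N by rewrite expn_gt0 prime_gt0.
have -> : y^-1 = (y ^+ (p ^ n))^-1 * y ^+ (p ^ n).-1.
  by apply: (mulIf y0); rewrite -mulrA -exprSr prednK // !mulVf // expf_neq0.
by apply: lspanMl; [|apply: subfieldV|apply: SX].
Qed.

(* With [q = p ^ n.+1], a divisor of [X ^ q - b ^ q = (X - b) ^ q] is some
   [(X - b) ^ m]; with coefficients in [G], its constant term puts
   [b ^ gcd(m, q)] in [G]. *)
Lemma pinsep_minpoly_degree G b n (P : {poly Omega}) : is_subfield G ->
  G (b ^+ (p ^ n.+1)) -> ~ G (b ^+ (p ^ n)) ->
  (forall i, G P`_i) -> (size P <= p ^ n.+1)%N -> P.[b] = 0 -> P = 0.
Proof.
move=> hG Gbq Gb GP sP Pb; apply/eqP/negPn/negP => P0; apply: Gb.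
have [k [j eG]] := subfield_range hG.
have [c _ jc] : range j (b ^+ (p ^ n.+1)) by rewrite -eG.
have /choice [f hf] i : exists a : k, j a = P`_i.
  by have := GP i; rewrite eG => -[a _ <-]; exists a.
set q := (p ^ n.+1)%N in jc sP Gbq *.
pose P' := \poly_(i < size P) f i.
have eP : map_poly j P' = P.
  apply/polyP => i; rewrite coef_map coef_poly; case: ltnP => [_|/leq_sizeP h].
    exact: hf.
  by rewrite h // raddf0.
(* The gcd is computed over [k], so the coefficients of its image in [Omega] lie in [G]. *)
pose D := gcdp P' ('X^q - c%:P).
have eQ : map_poly j ('X^q - c%:P) = ('X - b%:P) ^+ q.
  have hpP : p \in [pchar {poly Omega}] by rewrite pchar_poly.
  rewrite rmorphB /= map_polyXn map_polyC /= jc.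
  rewrite exprDn_pchar ?pnatX ?pnatE ?hpP //; congr (_ + _).
  (* Additivity of Frobenius gives [(- b) ^ q = - b ^ q] whatever the parity of [q]. *)
  apply/eqP; rewrite eq_sym -addr_eq0 [- b%:P]lock.
  rewrite polyC_exp -exprDn_pchar ?pnatX ?pnatE ?hpP // -lock addNr.
  by rewrite expr0n expn_eq0 -leqn0 leqNgt prime_gt0.
have eD : map_poly j D = gcdp P (('X - b%:P) ^+ q).
  by rewrite gcdp_map eP eQ.
have : map_poly j D %| ('X - b%:P) ^+ q by rewrite eD dvdp_gcdr.
case/dvdp_exp_XsubCP => m le_mq eqD.
have q0 : (0 < q)%N by rewrite expn_gt0 prime_gt0.
have m0 : (0 < m)%N.
  rewrite lt0n; apply/negP => /eqP m0; rewrite m0 expr0 in eqD.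
  have : 'X - b%:P %| map_poly j D.
    by rewrite eD dvdp_gcd dvdp_XsubCl /root Pb eqxx /= dvdp_exp.
  by rewrite (eqp_dvdr _ eqD) dvdp1 size_XsubC.
(* [D] divides [P], and a size is a degree plus one: [m + 1 <= size P <= q]. *)
have ltmq : (m < q)%N.
  have := eqp_size eqD; rewrite size_exp_XsubC => sD.
  rewrite -sD (leq_trans _ sP) // eD dvdp_leq //; exact: dvdp_gcdl.
have D0 : D != 0.
  rewrite gcdp_eq0 negb_and; apply/orP; left.
  by apply: contraNneq P0 => P'0; rewrite -eP P'0 rmorph0.
(* Made monic, [D] is [(X - b) ^ m]; evaluation at 0 gives [(- b) ^ m]. *)
have bm : G (b ^+ m).
  have /eqpP [[a1 a2] /= /andP[a10 a20] eqaD] := eqD.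
  have ja1 : a1 / a2 = (j (lead_coef D))^-1.
    have := congr1 lead_coef eqaD; rewrite !lead_coefZ lead_coef_map.
    rewrite (monicP (monic_exp _ (monicXsubC _))) mulr1 => <-.
    by rewrite invfM mulrA divff ?mul1r.
  have : ('X - b%:P) ^+ m = (j (lead_coef D))^-1 *: map_poly j D.
    by rewrite -ja1 mulrC -scalerA eqaD scalerA mulVf ?scale1r.
  move/(congr1 (fun Q => Q.[0])); rewrite hornerZ horner_exp hornerXsubC sub0r.
  rewrite -[X in _.[X]](rmorph0 j) horner_map exprNn -fmorphV -rmorphM => eb.
  have -> : b ^+ m = (-1) ^+ m * ((-1) ^+ m * b ^+ m) by rewrite signrMK.
  rewrite eb; apply: subfieldM => //; last first.
    by rewrite eG; exists ((lead_coef D)^-1 * D.[0]).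
  by apply: subfieldX => //; apply: subfieldN => //; apply: subfield1.
have [->|b0] := eqVneq b 0; first by rewrite frob0; apply: subfield0.
(* The gcd divides [q = p ^ n.+1], so it is a power of [p], and a proper divisor because it is at
   most [m < q]. *)
have [r le_rn er] : exists2 r, (r <= n)%N & gcdn m q = (p ^ r)%N.
  have /(dvdn_pfactor _ _ p_pr) [r le_rn er] : (gcdn m q %| p ^ n.+1)%N.
    exact: dvdn_gcdr.
  exists r => //; rewrite -ltnS ltn_neqAle le_rn andbT.
  apply: contraTneq ltmq => rn; rewrite -leqNgt /q -rn -er.
  by apply: dvdn_leq => //; apply: dvdn_gcdl.
(* Bezout: [u * m = v * q + gcd], with [b ^ m] and [b ^ q] both in [G]. *)
have bg : G (b ^+ (p ^ r)).
  rewrite -er; have [u v euv _] := egcdnP q m0.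
  have -> : b ^+ gcdn m q = (b ^+ m) ^+ u / (b ^+ q) ^+ v.
    rewrite -!exprM (mulnC m) euv (mulnC q) exprD mulrAC divff ?mul1r //.
    by rewrite expf_neq0.
  by apply: subfield_div => //; apply: subfieldX.
by rewrite -(subnKC le_rn) expnD exprM; apply: subfieldX.
Qed.

(** The powers of [b] span [F(b)] over [F], and since [b ^ (p ^ n)] lies in [F] their exponents can
    be reduced modulo [p ^ n]. *)
Lemma adjoin1_poly F b n x : is_subfield F -> F (b ^+ (p ^ n)) ->
  adjoin F [set b] x -> exists Q : {poly Omega},
    [/\ forall i, F Q`_i, (size Q <= p ^ n)%N & x = Q.[b]].
Proof.
move=> hF Fbq.
set q := (p ^ n)%N in Fbq *.
have q0 : (0 < q)%N by rewrite expn_gt0 prime_gt0.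
pose E := [set b ^+ i | i in [set: nat]].
have adjE : adjoin F E `<=` lspan F E.
  apply: adjoin_lspan => //.
  - move=> _ [i _ <-]; exists n; rewrite -exprM mulnC exprM.
    exact: subfieldX.
  - by exists 0%N.
  - by move=> _ _ [i _ <-] [i' _ <-]; exists (i + i')%N => //; rewrite exprD.
have sub : adjoin F [set b] `<=` lspan F E.
  apply: subset_trans adjE.
  apply: adjoin_min; [exact: adjoin_subfield|exact: adjoin_base|].
  by move=> _ ->; apply: adjoin_gen; exists 1%N.
move=> /sub; elim=> [|c _ {}x Fc [i _ <-] _ [Q [FQ sQ ->]]].
  exists 0; split=> [i||]; rewrite ?coef0 ?size_poly0 ?horner0 //.
  exact: subfield0.
exists ((c * (b ^+ q) ^+ (i %/ q)) *: 'X^(i %% q) + Q); split=> [l||].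
- rewrite coefD coefZ coefXn; apply: subfieldD => //; apply: subfieldM => //.
    by apply: subfieldM => //; apply: subfieldX.
  by case: eqP => _; [apply: subfield1|apply: subfield0].
- apply: leq_trans (size_polyD _ _) _; rewrite geq_max sQ andbT.
  by apply: leq_trans (size_scale_leq _ _) _; rewrite size_polyXn ltn_pmod.
- rewrite hornerD hornerZ hornerXn -mulrA -exprM -exprD mulnC.
  by rewrite -divn_eq.
Qed.

(* Otherwise [1, b, .., b ^ (p ^ n.+1 - 1)] would be linearly dependent over
   [F(a)], since [a] is one of their combinations over [F]. *)
Lemma notin_adjoin1 F a b n : is_subfield F -> F (b ^+ (p ^ n.+1)) ->
  ~ adjoin F [set a] (b ^+ (p ^ n)) -> ~ F a -> ~ adjoin F [set b] a.
Proof.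
move=> hF Fbq nb na /(adjoin1_poly hF Fbq) [Q [FQ sQ ea]]; apply: na.
have hG : is_subfield (adjoin F [set a]) by apply: adjoin_subfield.
(* This equality makes [a] the constant coefficient of [Q], which lies in [F]. *)
suff : Q - a%:P = 0.
  move=> /eqP; rewrite subr_eq0 => /eqP eQ.
  by have := FQ 0; rewrite eQ coefC.
apply: (pinsep_minpoly_degree (n := n) (b := b) hG) => //.
- exact: adjoin_base.
- move=> i; rewrite coefB coefC; apply: (subfieldB hG).
    exact: adjoin_base.
  by case: eqP => _; [exact: adjoin_gen|exact: (subfield0 hG)].
- apply: leq_trans (size_polyD _ _) _; rewrite geq_max sQ size_polyN size_polyC.
  by rewrite (leq_trans (leq_b1 _)) // expn_gt0 prime_gt0.
- by rewrite hornerD hornerN hornerC -ea subrr.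
Qed.

(** The spanning family may lie outside [F]: only an upper bound on the dimension matters. *)
Definition finite_span k F :=
  exists (T : finType) (y : T -> Omega), F `<=` lspan k (range y).

(** The products [y t * b ^ i] with [i < p ^ n] span [F(b)]. *)
Lemma finite_span_adjoin1 k F b n : is_subfield k -> is_subfield F ->
  F (b ^+ (p ^ n)) -> finite_span k F -> finite_span k (adjoin F [set b]).
Proof.
move=> hk hF Fbq [T [y Fy]].
exists (T * 'I_(p ^ n))%type, (fun u : T * 'I_(p ^ n) => y u.1 * b ^+ u.2).
move=> x /(adjoin1_poly hF Fbq) [Q [FQ sQ ->]].
rewrite (horner_coef_wide _ sQ); apply: big_ind => [||i _]; first by left.
  exact: lspanD.
elim: (Fy _ (FQ i)) => [|c _ z kc [t _ <-] _ IH]; first by rewrite mul0r; left.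
by rewrite mulrDl -mulrA; apply: lspanMD => //; exists (t, i).
Qed.

End Frobenius.

(** * Modular, relatively perfect extensions *)

Section RelativelyPerfect.
Variables (Omega : fieldType) (p : nat) (hp : p \in [pchar Omega]).
Variables (k K : set Omega).
Hypotheses (hk : is_subfield k) (hK : is_subfield K) (kK : k `<=` K).
Hypotheses (hpi : purely_inseparable p k K) (hmod : modular p k K).

(** An exponent [e] for [k(K^(p^m))] would give the exponent [m + e] for [K], so this field cannot
    be a proper subextension. *)
Lemma w0_generated_adjoin_frob m : unbounded_exponent p k K ->
  w0_generated p k K -> K `<=` adjoin k (frob_image p m K).
Proof.
move=> hunb hw0 x Kx; apply: contra_notP hw0 => nx.
exists (adjoin k (frob_image p m K)); split.
- split; [exact: adjoin_subfield|exact: adjoin_base|].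
  by apply: adjoin_min => // _ [y Ky <-]; apply: subfieldX.
- by move=> eK; apply: nx; rewrite eK.
- move=> [e he]; apply: hunb; exists (m + e)%N => _ [y Ky <-].
  rewrite expnD exprM; apply: he; exists (y ^+ (p ^ m)) => //.
  by apply: adjoin_gen; exists y.
Qed.

(** That is, [K] is relatively perfect over [k]. *)
Hypothesis hperf : forall m, K `<=` adjoin k (frob_image p m K).

Local Notation Kn n := (frob_preimage p n k `&` K).

Lemma Kn_subfield n : is_subfield (Kn n).
Proof. by apply: setI_subfield => //; apply: frob_preimage_subfield. Qed.

(** Here [E] may be infinite; the finite family extracted from it is what allows induction on the
    number of terms. *)
Lemma lspan_ord F E x : is_subfield F -> lspan F E x ->
  exists r (c y : 'I_r -> Omega),
    [/\ forall i, F (c i), forall i, E (y i) & x = \sum_i c i * y i].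
Proof.
move=> hF; elim=> [|c y {}x Fc Ey _ [r [d [z [Fd Ez ->]]]]].
  by exists 0%N, (fun=> 0), (fun=> 0); split=> [[]|[]|] //; rewrite big_ord0.
exists r.+1, (extend d c), (extend z y); split; [exact: extend_all..|].
by rewrite big_ord_recl !extend0; under [in RHS]eq_bigr do rewrite !extend_lift.
Qed.

(* As long as [1] and the [y j ^ (p ^ m.+1)] are dependent over
   [K ^ (p ^ m.+1) ∩ k], some [y j ^ (p ^ m)] can be eliminated; once they are
   independent, so they are over [k], and [x ^ p ∈ k] forces [x = A0]. *)
Lemma modular_eliminate m r A0 (A y : 'I_r -> Omega) :
  let S := adjoin k (frob_image p m (Kn m.+1)) in
  S A0 -> (forall j, S (A j)) -> (forall j, K (y j)) ->
  k ((A0 + \sum_j A j * y j ^+ (p ^ m)) ^+ (p ^ 1)) ->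
  S (A0 + \sum_j A j * y j ^+ (p ^ m)).
Proof.
move=> S; have hS : is_subfield S by apply: adjoin_subfield.
have frob_m1 z : (z ^+ (p ^ m)) ^+ (p ^ 1) = z ^+ (p ^ m.+1) :> Omega.
  by rewrite -exprM -expnD addn1.
have Sp : S `<=` frob_preimage p 1 k.
  apply: (adjoin_min (frob_preimage_subfield hp 1 hk)).
    by move=> z kz; rewrite /frob_preimage /=; apply: subfieldX.
  by move=> _ [h [kh _] <-]; rewrite /frob_preimage /= frob_m1.
elim: r A0 A y => [|r IH] A0 A y SA0 SA Ky; first by rewrite big_ord0 addr0.
set x := A0 + _ => kx.
pose v := extend (fun j => y j ^+ (p ^ m)) 1.
have v0 : v ord0 = 1 by rewrite /v extend0.
have vl j : v (lift ord0 j) = y j ^+ (p ^ m) by rewrite /v extend_lift.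
pose w i := v i ^+ (p ^ 1).
have wK i : frob_image p m.+1 K (w i).
  rewrite /w; case: (unliftP ord0 i) => [j ->|->]; rewrite ?v0 ?vl.
    by exists (y j); rewrite ?frob_m1.
  by exists 1; [exact: subfield1|rewrite !expr1n].
have [iw|dw] := pselect (lin_indep (frob_image p m.+1 K `&` k) w).
  have iwk := hmod wK iw.
  (* The [p]-th power of the expression for [x], with [x ^ p] moved to the coefficient of 1, is a
     relation over [k]. *)
  pose c := extend (fun j => A j ^+ (p ^ 1)) (A0 ^+ (p ^ 1) - x ^+ (p ^ 1)).
  have kc : forall i, k (c i).
    by apply: extend_all => [|j]; [apply: subfieldB => //; apply: Sp|apply: Sp].
  have sc : \sum_i c i * w i = 0.
    rewrite big_ord_recl /c /w v0 expr1n mulr1 extend0.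
    under eq_bigr => j _ do rewrite extend_lift vl -exprMn.
    by rewrite -(frob_sum hp) addrAC -(frobD hp) subrr.
  have A0' j : A j = 0.
    apply: (frob_inj hp (n := 1)) => /=; rewrite (frob0 hp).
    by have := iwk c kc sc (lift ord0 j); rewrite /c extend_lift.
  by rewrite /x big1 ?addr0 // => j _; rewrite A0' mul0r.
have [d [Cd sd [i0 di0]]] := not_lin_indepP dw.
(* Each [d i] is a [p ^ m.+1]-th power of some [h i] in [K] and lies in [k], so [h i] is in
   [Kn m.+1] and the [p]-th root [e i] of [d i] is in [S]. *)
have /choice [h hh] i : exists g, Kn m.+1 g /\ g ^+ (p ^ m.+1) = d i.
  have [[g Kg eg] kd] := Cd i; exists g; split=> //; split=> //.
  by rewrite /frob_preimage /= eg.
pose e i := h i ^+ (p ^ m).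
have Se i : S (e i).
  by apply: adjoin_gen; exists (h i) => //; case: (hh i).
have ed i : e i ^+ (p ^ 1) = d i by rewrite /e frob_m1; case: (hh i).
have se : \sum_i e i * v i = 0.
  apply: (frob_inj hp (n := 1)); rewrite /= (frob_sum hp) (frob0 hp) -[RHS]sd.
  by apply: eq_bigr => i _; rewrite exprMn ed.
(* A relation involving 1 alone would be trivial, so some [y j] occurs in it. *)
have [j dj] : exists j : 'I_r.+1, d (lift ord0 j) != 0.
  apply: contra_notP (negP di0) => nd; apply/eqP.
  have dl j : d (lift ord0 j) = 0.
    by apply/eqP/negPn/negP => dj; apply: nd; exists j.
  case: (unliftP ord0 i0) => [j -> //|->].
  move: sd; rewrite big_ord_recl big1 => [|l _]; last by rewrite dl mul0r.
  by rewrite addr0 /w v0 expr1n mulr1.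
have ej : e (lift ord0 j) != 0.
  by apply: contraNneq dj => ej; rewrite -ed ej (frob0 hp).
pose a := A j / e (lift ord0 j).
(* Subtracting [a] times the relation [se] leaves [x] unchanged and cancels the term of index
   [j]. *)
pose B0 := A0 - a * e ord0.
pose B l := A (lift j l) - a * e (lift ord0 (lift j l)).
have Sa : S a by apply: (subfield_div hS).
have eB : x = B0 + \sum_l B l * y (lift j l) ^+ (p ^ m).
  have eA : A j = a * e (lift ord0 j) by rewrite /a divfK.
  have ex : x = x - a * \sum_i e i * v i by rewrite se mulr0 subr0.
  rewrite [LHS]ex /x [\sum_(i < r.+2) _]big_ord_recl.
  rewrite !(bigD1_ord j) //= v0 mulr1 vl eA.
  under [in LHS]eq_bigr do rewrite ?vl.
  rewrite !mulrDr opprD addrACA; congr (_ + _).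
  rewrite mulrA opprD addrACA subrr add0r mulr_sumr -sumrB.
  by apply: eq_bigr => l _; rewrite vl mulrBl mulrA.
rewrite eB; apply: IH => //.
- by apply: (subfieldB hS) => //; apply: (subfieldM hS).
- by move=> l; apply: (subfieldB hS) => //; apply: (subfieldM hS).
- by rewrite -eB.
Qed.

Lemma adjoin_frob_lspan L m : is_subfield L -> L `<=` K ->
  adjoin k (frob_image p m L) `<=` lspan k (frob_image p m L).
Proof.
move=> hL LK; have hE := frob_image_subfield hp m hL.
apply: (adjoin_lspan hp) => //.
- by move=> _ [y Ly <-]; apply: hpi; apply: subfieldX => //; apply: LK.
- exact: subfield1.
- by move=> a b; apply: subfieldM.
Qed.

(** [hperf] expands [x] over [k] in [p ^ m]-th powers of elements of [K], and [modular_eliminate]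
    trades these for powers of elements of [Kn m.+1]. *)
Lemma K1_sub_adjoin m : Kn 1 `<=` adjoin k (frob_image p m (Kn m.+1)).
Proof.
move=> x [kx Kx].
have := adjoin_frob_lspan hK (@subset_refl _ K) (@hperf m x Kx).
case/lspan_ord => // r [c [y [kc Ey ex]]].
have /choice [z hz] i : exists z, K z /\ z ^+ (p ^ m) = y i.
  by have [z Kz <-] := Ey i; exists z.
have ex' : x = 0 + \sum_i c i * z i ^+ (p ^ m).
  by rewrite add0r ex; apply: eq_bigr => i _; case: (hz i) => _ ->.
have hS := adjoin_subfield k (frob_image p m (Kn m.+1)).
rewrite ex'; apply: modular_eliminate.
- exact: subfield0.
- by move=> i; apply: adjoin_base.
- by move=> i; case: (hz i).
- by rewrite -ex'.
Qed.

Lemma K1_sub_lspan m : Kn 1 `<=` lspan k (frob_image p m (Kn m.+1)).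
Proof.
apply: subset_trans (@K1_sub_adjoin m) _.
by apply: adjoin_frob_lspan => [|x []//]; apply: Kn_subfield.
Qed.

Lemma frob_image_sub_K1 m : frob_image p m (Kn m.+1) `<=` Kn 1.
Proof.
move=> _ [y [ky Ky] <-]; split; last exact: subfieldX.
by rewrite /frob_preimage /= -exprM -expnD addn1.
Qed.

(** * Finiteness of [Kn 1] over [k] *)

Definition bounded_rank D := forall m (x : 'I_m -> Omega),
  (forall i, Kn 1 (x i)) -> lin_indep k x -> (m <= D)%N.

Lemma finite_span_bounded_rank F : Kn 1 `<=` F -> finite_span k F ->
  exists D, bounded_rank D.
Proof.
move=> KF [T [y Fy]]; exists #|T| => m x Kx ix.
by apply: (lin_indep_card hk ix) => i; apply: Fy; apply: KF.
Qed.

(** The invariant of the tower: finiteness over [k] is carried along because [F(a)] must be too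
    small to contain [Kn 1]. *)
Definition avoids a F :=
  [/\ is_subfield F, k `<=` F, F `<=` K, finite_span k F & ~ F a].

Lemma avoids_extend a : Kn 1 a -> ~ (exists D, bounded_rank D) ->
  forall F n, avoids a F -> exists G,
    [/\ avoids a G, F `<=` G & exists2 b, G b & ~ k (b ^+ (p ^ n))].
Proof.
move=> [ka Ka] unb F n [hF kF FK sF na].
(* If every such power were in [F(a)], then [K1_sub_adjoin] would put [Kn 1] inside a finite
   extension of [k]. *)
have [b Kb nb] : exists2 b, Kn n.+1 b & ~ adjoin F [set a] (b ^+ (p ^ n)).
  apply: contra_notP unb => nb.
  apply: (@finite_span_bounded_rank (adjoin F [set a])).
    apply: subset_trans (@K1_sub_adjoin n) _; apply: adjoin_min.
    - exact: adjoin_subfield.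
    - by apply: subset_trans kF _; apply: adjoin_base.
    - by move=> _ [b Kb <-]; apply: contra_notP nb => nb; exists b.
  (* The exponent is 1 since [a] is in [Kn 1]. *)
  by apply: (finite_span_adjoin1 hp hk hF (n := 1)) => //; apply: kF.
have [kb Kb'] := Kb; have Fb : F (b ^+ (p ^ n.+1)) by apply: kF.
exists (adjoin F [set b]); split.
- split.
  + exact: adjoin_subfield.
  + by apply: subset_trans kF _; apply: adjoin_base.
  + by apply: adjoin_min => // _ ->.
  + exact: (finite_span_adjoin1 hp hk hF Fb).
  + exact: (notin_adjoin1 hp hF Fb).
- exact: adjoin_base.
- exists b; first by apply: adjoin_gen.
  by apply: contra_not nb => kbn; apply: adjoin_base; apply: kF.
Qed.

Lemma finite_span_base : finite_span k k.
Proof.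
exists unit, (fun=> 1) => x kx; rewrite -[x]mulr1; apply: lspanMl => //.
by apply: lspan_gen => //; exists tt.
Qed.

Lemma w0_generated_bounded_rank :
  w0_generated p k K -> exists D, bounded_rank D.
Proof.
move=> hw0; apply: contrapT => unb; apply: hw0.
have [a Ka nka] : exists2 a, Kn 1 a & ~ k a.
  apply: contra_notP unb => na; apply: (@finite_span_bounded_rank k).
    by move=> x Kx; apply: contra_notP na => nkx; exists x.
  exact: finite_span_base.
(* The stage number is part of the argument, as it fixes the exponent to exceed. Outside the
   invariant the value [u.1] is an arbitrary default. *)
have /choice [next hnext] (u : set Omega * nat) : exists G, avoids a u.1 ->
    [/\ avoids a G, u.1 `<=` G & exists2 b, G b & ~ k (b ^+ (p ^ u.2))].
  have [au|nau] := pselect (avoids a u.1); last by exists u.1.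
  by have [G hG] := avoids_extend Ka unb u.2 au; exists G.
pose F := fix F n := if n is n'.+1 then next (F n', n') else k.
have aF n : avoids a (F n).
  elim: n => [|n IH]; first by split=> //; exact: finite_span_base.
  by case: (hnext (F n, n) IH).
have FS n : F n `<=` F n.+1 by case: (hnext (F n, n) (aF n)).
have Fle m n : (m <= n)%N -> F m `<=` F n.
  move/subnKC <-; elim: (n - m)%N => [|l IH]; first by rewrite addn0.
  by rewrite addnS; apply: subset_trans IH (FS _).
exists (\bigcup_n F n); split.
- split; last by move=> x [n _ Fx]; case: (aF n) => _ _ FK _ _; apply: FK.
    have common x y : (\bigcup_n F n) x -> (\bigcup_n F n) y ->
        exists n, F n x /\ F n y.
      move=> [m _ Fx] [n _ Fy]; exists (maxn m n).
      by split; [apply: Fle Fx; exact: leq_maxl|apply: Fle Fy; exact: leq_maxr].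
    apply/is_subfieldP; split=> [|x y Fx Fy|x y Fx Fy].
    + by exists 0%N => //; apply: subfield1.
    + have [n [Fxn Fyn]] := common _ _ Fx Fy; exists n => //.
      by case: (aF n) => hFn _ _ _ _; apply: subfieldB.
    + have [n [Fxn Fyn]] := common _ _ Fx Fy; exists n => //.
      by case: (aF n) => hFn _ _ _ _; apply: subfield_div.
  by move=> x kx; exists 0%N.
- move=> eK; have : (\bigcup_n F n) a by rewrite eK; case: Ka.
  by move=> [n _]; case: (aF n).
(* An exponent [e] for the union fails at stage [e.+1], which contains some [b] with [b ^ (p ^ e)]
   outside [k]. *)
- move=> [e he]; have [_ _ [b Fb nb]] := hnext (F e, e) (aF e).
  by apply: nb; apply: he; exists b => //; exists e.+1.
Qed.

(** * Bounded generation of the [Kn n] *)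

Lemma Kn_generated D n : bounded_rank D ->
  exists r (z : 'I_r -> Omega), [/\ (r <= D)%N, forall i, Kn n.+1 (z i) &
    Kn n.+1 `<=` adjoin k (range z)].
Proof.
move=> hD; set E := frob_image p n (Kn n.+1).
(* A longest independent family in [E] is taken: lengths are bounded by [D], and the empty family is
   a start. *)
pose P r := `[< exists y : 'I_r -> Omega,
  (forall i, E (y i)) /\ lin_indep k y >].
have exP : exists r, P r.
  exists 0%N; apply/asboolP; exists (fun=> 0); split=> [[]//|].
  by move=> c _ _ [].
have leP r : P r -> (r <= D)%N.
  move=> /asboolP [y [Ey iy]]; apply: hD iy => i.
  by apply: frob_image_sub_K1 (Ey i).
case: (ex_maxnP exP leP) => r Pr rmax.
have rD := leP r Pr; move/asboolP: Pr => [y [Ey iy]].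
have Ey' : E `<=` lspan k (range y).
  move=> e Ee; apply: extend_dep_lspan => // ie.
  suff : (r.+1 <= r)%N by rewrite ltnn.
  apply: rmax; apply/asboolP; exists (extend y e); split=> //.
  exact: extend_all.
have K1y : Kn 1 `<=` lspan k (range y).
  by apply: subset_trans (@K1_sub_lspan n) _; apply: lspan_trans.
have /choice [z hz] i : exists z, Kn n.+1 z /\ z ^+ (p ^ n) = y i.
  by have [z Kz <-] := Ey i; exists z.
exists r, z; split=> // [i|]; first by case: (hz i).
have hkz := adjoin_subfield k (range z).
suff : forall j, (j <= n.+1)%N -> Kn j `<=` adjoin k (range z) by apply.
elim=> [_ x [kx _]|j IH le_jn].
  by apply: adjoin_base; rewrite /frob_preimage /= expn0 expr1 in kx.
move=> x Kx; have [kx Kx'] := Kx.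
have yK i : frob_image p j K (y i).
  exists (z i ^+ (p ^ (n - j))).
    by apply: subfieldX => //; case: (hz i) => -[].
  by rewrite -exprM -expnD subnK //; case: (hz i).
(* [x ^ (p ^ j)] is in [Kn 1], hence dependent on [y] over [k]; by modularity it is so already over
   the smaller field [K^(p^j) ∩ k]. *)
have dep : ~ lin_indep (frob_image p j K `&` k) (extend y (x ^+ (p ^ j))).
  have xy : lspan k (range y) (x ^+ (p ^ j)).
    by apply: K1y; apply: (@frob_image_sub_K1 j); exists x.
  move=> /hmod ik; apply: (lspan_extend_dep hk xy); apply: ik.
  by apply: extend_all => //; exists x.
have hC := setI_subfield (frob_image_subfield hp j hK) hk.
have iyC : lin_indep (frob_image p j K `&` k) y.
  by apply: lin_indepS iy => c [].
(* A coefficient is [h ^ (p ^ j)] and lies in [k], so [h] is in [Kn j] and [IH] applies; with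
   [y i = (z i ^ (p ^ (n - j))) ^ (p ^ j)], a [p ^ j]-th root can be taken term by term. *)
have [w kw ew] : exists2 w, adjoin k (range z) w & w ^+ (p ^ j) = x ^+ (p ^ j).
  elim: (extend_dep_lspan hC iyC dep) =>
    [|c _ u [[h Kh eh] kc] [i _ <-] _ [w kw <-]].
    by exists 0; [exact: (subfield0 hkz)|rewrite !(frob0 hp)].
  exists (h * z i ^+ (p ^ (n - j)) + w).
    apply: (subfieldD hkz) => //; apply: (subfieldM hkz).
      by apply: (IH (ltnW le_jn)); split; rewrite // /frob_preimage /= eh.
    by apply: (subfieldX hkz); apply: adjoin_gen; exists i.
  rewrite (frobD hp) exprMn eh -exprM -expnD subnK //.
  by case: (hz i) => _ ->.
by rewrite -(frob_inj hp ew).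
Qed.

End RelativelyPerfect.

(** * [r]-bases and the cardinal [di] *)

Lemma min_generators_r_basis (Omega : fieldType) (p : nat) (k L : set Omega) r
    (z : 'I_r -> Omega) :
  is_subfield L -> k `<=` L -> (forall i, L (z i)) ->
  L `<=` adjoin k (range z) ->
  exists2 B : set Omega, r_basis p k L B & (B #<= `I_r)%card.
Proof.
move=> hL kL zL Lz; set kLp := adjoin k (frob_image p 1 L).
(* A shortest family generating [L] over [k(L^p)] is an [r]-basis, since a redundant member could be
   dropped. *)
pose P s := `[< exists y : 'I_s -> Omega,
  (forall i, L (y i)) /\ L `<=` adjoin kLp (range y) >].
have Pr : P r.
  apply/asboolP; exists z; split=> //; apply: subset_trans Lz _.
  apply: adjoin_min; [exact: adjoin_subfield| |exact: adjoin_gen].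
  by apply: subset_trans (@adjoin_base _ _ _); apply: adjoin_base.
case: (ex_minnP (ex_intro P r Pr)) => s /asboolP [y [Ly genL]] smin.
have kLpL : kLp `<=` L.
  by apply: adjoin_min => // _ [x Lx <-]; apply: subfieldX.
exists (range y).
  split=> [_ [i _ <-] //||].
    apply/seteqP; split=> //; apply: adjoin_min => // _ [i _ <-] //.
  move=> _ [i _ <-]; case: s y Ly genL smin i => [|s] y Ly genL smin i yi.
    by case: (i).
  suff : (s.+1 <= s)%N by rewrite ltnn.
  apply: smin; apply/asboolP; exists (y \o lift i).
  split=> [j|]; first exact: Ly.
  have hadj := adjoin_subfield kLp (range (y \o lift i)).
  apply: subset_trans genL _; apply: adjoin_min => //; first exact: adjoin_base.
  (* Only an inclusion is claimed, because [y] might repeat the value [y i] at another index. *)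
  have sub : adjoin kLp (range y `\ y i) `<=` adjoin kLp (range (y \o lift i)).
    apply: adjoin_min => //; first exact: adjoin_base.
    move=> _ [[j _ <-]]; case: (unliftP i j) => [l -> _|-> []//].
    by apply: adjoin_gen; exists l.
  move=> _ [j _ <-]; case: (unliftP i j) => [l ->|->]; last exact: sub.
  by apply: adjoin_gen; exists l.
have := smin r Pr; rewrite -card_le_II; apply: card_le_trans.
(* [y] is continued by 0 to all natural numbers, so that [range y] lies in the image of the first
   [s] of them. *)
pose f i := if insub i is Some j then y j else 0.
apply: card_le_trans (card_image_le f `I_s); apply: subset_card_le.
by move=> _ [i _ <-]; exists (val i); [exact: ltn_ord|rewrite /f valK].
Qed.

(** The least natural number that is an upper bound is the supremum: a finite competitor [E] is
    handled by minimality, and an infinite one dominates every finite cardinal. *)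
Lemma q_finiteP (Omega : fieldType) (p : nat) (k K : set Omega) (D : nat) :
  di_upper_bound p k K `I_D -> q_finite p k K.
Proof.
move=> hD; pose P d := `[< di_upper_bound p k K `I_d >].
have PD : P D by apply/asboolP.
case: (ex_minnP (ex_intro P D PD)) => d /asboolP hd dmin.
exists d; split=> // E hE.
have [finE|infE] := pselect (finite_set E).
  have [e Ee] := finE.
  have /dmin : P e.
    apply/asboolP => n n1; have [B hB BE] := hE n n1; exists B => //.
    by rewrite -(card_le_eqr Ee).
  by rewrite (card_le_eqr Ee) card_le_II.
apply: card_le_trans (proj1 (infiniteP _) infE).
exact: subset_card_le.
Qed.

Theorem mainTheorem5 (p : nat) (k : fieldType) (hp : p \in [pchar k])
    (Omega : closedFieldType) (iota : {rmorphism k -> Omega})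
    (Omega_alg : forall x : Omega, algebraicOver iota x)
    (K : set Omega)
    (hK : subextension (range iota) K [set: Omega])
    (hpi : purely_inseparable p (range iota) K)
    (hunb : unbounded_exponent p (range iota) K)
    (hmod : modular p (range iota) K)
    (hw0 : w0_generated p (range iota) K) :
  q_finite p (range iota) K.
Proof.
have hpO : p \in [pchar Omega] by apply: (rmorph_pchar iota).
have hk : is_subfield (range iota).
  apply/is_subfieldP; split.
  - by exists 1 => //; rewrite rmorph1.
  - by move=> _ _ [x _ <-] [y _ <-]; exists (x - y) => //; rewrite rmorphB.
  - by move=> _ _ [x _ <-] [y _ <-]; exists (x / y) => //; rewrite fmorph_div.
have [hKf kK _] := hK.
have hperf m := w0_generated_adjoin_frob hKf kK (m := m) hunb hw0.
have [D hD] := w0_generated_bounded_rank hpO hk hKf kK hpi hmod hperf hw0.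
(* Only [n >= 1] is asked for, which matches the levels [n.+1] of [Kn_generated]. *)
apply: (@q_finiteP _ _ _ _ D) => -[//|n] _.
have [r [z [rD Kz genz]]] := Kn_generated hpO hk hKf hpi hmod hperf n hD.
have [||B hB Br] := @min_generators_r_basis _ p (range iota) _ _ z _ _ Kz genz.
- by apply: setI_subfield => //; apply: frob_preimage_subfield.
- by move=> x kx; split; [exact: (subfieldX hk)|exact: kK].
by exists B => //; apply: (card_le_trans Br); rewrite card_le_II.
Qed.
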